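(* For every $\varepsilon>0$ and every constant $c_0>0$ there is a constant $C=C(\varepsilon,c_0)>0$ such that for all real numbers $N\ge 1$ and $X>0$ with $N\ge c_0X^{1/2}$, setting $M=N^{2/3}$ (so that $M^3=N^2$), we have $$T(N,X)\le C\Big(\frac{XM}{N}+N^{1/3+\varepsilon}\Big).$$
   Context: For real $N\ge 1$ and $X>0$, $T(N,X)$ denotes the number of pairs of integers $(m,n)$ with $m\in\mathbb{Z}$, $N\le n\le 2N$ and $|n^2-m^3|\le X$. *)

(* Defs.v *)
From HB Require Import structures.
From mathcomp Require Import all_boot all_order all_algebra finmap.
From mathcomp Require Import lra zify.
From mathcomp Require Import all_classical all_reals all_analysis.

Set Implicit Arguments.
Unset Strict Implicit.
Unset Printing Implicit Defensive.

Import Order.TTheory GRing.Theory Num.Theory.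

Local Open Scope classical_set_scope.
Local Open Scope ring_scope.

Definition near_pairs (R : realType) (N X : R) : set (int * int) :=
  [set p | let: (m, n) := p in
    N <= n%:~R <= 2 * N /\ `|n%:~R ^+ 2 - m%:~R ^+ 3| <= X].

(* [fset_set] returns the empty set on an infinite argument; [finite_near_pairs]
   below shows that this junk value never occurs in [T]. *)
Definition T (R : realType) (N X : R) : nat := #|` fset_set (near_pairs N X)|.

Lemma finite_near_pairs (R : realType) (N X : R) : finite_set (near_pairs N X).
Proof.
have finI (k : nat) : finite_set [set z : int | (`|z| <= k)%N].
  apply: (@sub_finite_set _ _
    ((fun i : nat => Posz i) @` `I_k.+1 `|` (fun i : nat => - Posz i) @` `I_k.+1)).
    move=> z /= zk; have [z0|z0] := leP 0 z; [left|right]; exists `|z|%N => //; lia.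
  by rewrite finite_setU; split; apply: finite_image; exact: finite_II.
pose B := Num.max 0 (2 * N); pose D := B ^+ 2 + X.
apply: (@sub_finite_set _ _ ([set z : int | (`|z| <= Num.truncn D)%N] `*`
                             [set z : int | (`|z| <= Num.truncn B)%N]));
  last by apply: finite_setX; exact: finI.
have absE (z : int) (b : R) : `|z%:~R : R| <= b -> (`|z| <= Num.truncn b)%N.
  by rewrite -intr_norm -natr_absz => zb; rewrite truncn_ge_nat // (le_trans _ zb).
move=> [m n] /= [/andP[Nn n2N] mnX].
have nB : `|n%:~R : R| <= B.
  rewrite ger0_norm ?le_max ?n2N ?orbT //; lra.
split; apply: absE => //.
have [->|m0] := eqVneq m 0.
  rewrite normr0 /D addr_ge0 ?sqr_ge0 //; exact: le_trans (normr_ge0 _) mnX.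
have m1 : 1 <= `|m%:~R : R| by rewrite -intr_norm ler1z; lia.
apply: (@le_trans _ _ (`|m%:~R : R| ^+ 3)); first by rewrite ler_eXnr.
rewrite -normrX.
have -> : (m%:~R : R) ^+ 3 = n%:~R ^+ 2 - (n%:~R ^+ 2 - m%:~R ^+ 3).
  by rewrite opprB addrC subrK.
apply: le_trans (ler_normB _ _) _; apply: lerD => //.
by rewrite normrX lerXn2r ?nnegrE // le_max lexx.
Qed.

(* Main.v *)
Require Import Defs.
From HB Require Import structures.
From mathcomp Require Import all_boot all_order all_algebra finmap.
From mathcomp Require Import ring lra zify.
From mathcomp Require Import all_classical all_reals all_analysis.

(** Write [rho = N^(1/3)]; the claim is [T(N,X) << X/rho + rho^(1+3eps)].

For [X >= N] a trivial count suffices: there are [O(rho^2)] values of [m], and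
for each of them the possible [n] lie in an interval of length [X/N >= 1].
For [X <= N] one may enlarge [X] to at least [rho^2]. The points are then
integer points very close to the curve [(t^2, t^3)], and they are counted by
means of the tangent lines of this curve. If [t^2] is close to [m], then
[2n - 3tm + t^3] is small, because [2w^3 - 3tw^2 + t^3 = (w - t)^2 (2w + t)].
Let [t] run through the fractions with denominator [H] and write
[t = j + k/H] with [0 <= k < H]. The crucial point is the identity
[2n - 3tm + t^3 = f(k/H) + (k/H)^3], where
[f(Y) = 3j Y^2 + 3(j^2 - m) Y + (2n - 3jm + j^3)]
is an integral binary quadratic form: the integral part [j] of [t] disappears
into an integral change of variables. So for fixed [k] the points [(m, n)]
inject into the integral quadratic forms [f] for which the three numbers
[f''(k/H)/2], [f'(k/H)], [f(k/H)] lie in intervals of lengths of order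
[AH], [A], [A/H], where [A = rho/H] and [H] is about [rho^2/sqrt X].

These forms are counted by reduction theory. The lattice of the vectors
[(rH - sk, s)] has a basis which is reduced in the sense of Gauss, with squared
lengths [g1 <= g2] and [g1 g2 <= 2H^2] ([gauss_reduction]). A form is
determined by its values at, and its polar value between, the two basis vectors,
and these are integers confined to intervals of lengths [<< A g1/H], [A],
[A H/g1]. This gives [<< A^3 + A^2 H/g1] forms ([size_le_reduced_box]).
The first term, summed over [k], is [A^2 rho], of order [X/rho]. The quantity
[H/g1] is the height in the upper half-plane of the reduced point equivalent
to [(k + i)/H], and such heights are only logarithmically large on average
([sum_height_le]). So the second term contributes [A rho log rho], which
is at most [A^2 rho + rho (log rho)^2]. *)

Set Implicit Arguments.
Unset Strict Implicit.
Unset Printing Implicit Defensive.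

Import Order.TTheory GRing.Theory Num.Theory.

Local Open Scope ring_scope.

(** * Counting by fibres of integer-valued functions *)

Lemma size_le_diameter (R : realType) (s : seq int) (D : R) : uniq s ->
  {in s &, forall x y, `|x%:~R - y%:~R| <= D} -> 0 <= D ->
  (size s)%:R <= 2 * D + 1.
Proof.
case: s => [|x0 s0] us diam D0; first by rewrite /=; lra.
set s := x0 :: s0 in us diam *; set d := Num.truncn D.
pose f (x : int) := absz (x - x0 + d%:Z).
have closeP x : x \in s -> (`|x - x0| <= d)%N.
  move=> xs; rewrite truncn_ge_nat // natr_absz intr_norm rmorphB /=.
  by apply: diam => //; rewrite mem_head.
have finj : {in s &, injective f}.
  by move=> x y /closeP xd /closeP yd; rewrite /f; lia.
have : (size s <= d.*2.+1)%N.
  rewrite -(size_map f) -[leqRHS](size_iota 0).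
  apply: uniq_leq_size; first by rewrite map_inj_in_uniq.
  by move=> _ /mapP[x /closeP xd ->]; rewrite mem_iota /f; lia.
rewrite -(ler_nat R) => /le_trans; apply.
have : d%:R <= D by rewrite /d truncn_le.
by rewrite -addn1 natrD -muln2 natrM; lra.
Qed.

Lemma size_fibres (T U : eqType) (s : seq T) (r : seq U) (f : T -> U) :
  uniq r -> {subset map f s <= r} ->
  size s = (\sum_(z <- r) size [seq x <- s | f x == z])%N.
Proof.
move=> ur fsr; under eq_bigr do rewrite size_filter -sum1_count.
rewrite (exchange_big_dep predT) //= -[LHS]sum1_size big_seq [RHS]big_seq.
apply: eq_bigr => x xs; rewrite sum1_count.
rewrite (@eq_count _ _ (pred1 (f x))) => [|z]; last by rewrite /= eq_sym.
by rewrite count_uniq_mem ?fsr ?map_f.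
Qed.

Lemma size_le_diameter_fibre (R : realType) (T : eqType) (s : seq T)
    (f : T -> int) (D K : R) :
  {in s &, forall x y, `|(f x)%:~R - (f y)%:~R| <= D} -> 0 <= D -> 0 <= K ->
  (forall z, (size [seq x <- s | f x == z])%:R <= K) ->
  (size s)%:R <= (2 * D + 1) * K.
Proof.
move=> diam D0 K0 fib; rewrite (@size_fibres _ _ s (undup (map f s)) f) ?undup_uniq //;
  last by move=> z; rewrite mem_undup.
rewrite natr_sum.
apply: (@le_trans _ _ (\sum_(z <- undup (map f s)) K)).
  by apply: ler_sum => z _; exact: fib.
rewrite big_const_seq count_predT iter_addr_0 -[leLHS]mulr_natl.
apply: ler_wpM2r => //; apply: size_le_diameter => //; first exact: undup_uniq.
move=> z1 z2; rewrite !mem_undup => /mapP[x xs ->] /mapP[y ys ->].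
exact: diam.
Qed.

(** * Reduction theory *)

(** Euclid's algorithm in the plane: the second vector is made as orthogonal as
    possible to the first one by adding a multiple of it, and the two are
    exchanged as long as this shortens the first. The last bound is Lagrange's
    identity [g1 g2 = w^2 + H^2], where the inner product [w] satisfies
    [2|w| <= g1], so that [4w^2 <= g1 g2]. *)
Lemma gauss_reduction (H k : int) : 0 < H ->
  exists r s p q : int,
    let X1 := r * H - s * k in let X2 := p * H - q * k in
    let g1 := X1 ^+ 2 + s ^+ 2 in let g2 := X2 ^+ 2 + q ^+ 2 in
    [/\ (r * q - s * p) ^+ 2 = 1, 0 <= s, 0 < g1, g1 <= g2
      & g1 * g2 <= 2 * H ^+ 2].
Proof.
move=> H0.
suff: forall (n : nat) (r s p q : int), (r * q - s * p) ^+ 2 = 1 ->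
    (r * H - s * k) ^+ 2 + s ^+ 2 <= n%:Z ->
  exists r s p q : int,
    let X1 := r * H - s * k in let X2 := p * H - q * k in
    let g1 := X1 ^+ 2 + s ^+ 2 in let g2 := X2 ^+ 2 + q ^+ 2 in
    [/\ (r * q - s * p) ^+ 2 = 1, 0 < g1, g1 <= g2
      & g1 * g2 <= 2 * H ^+ 2].
  move=> /(_ `|H ^+ 2|%N 1 0 0 1)[||r [s [p [q [dt g0 g12 gg]]]]].
  - by rewrite mul1r mulr0 subr0.
  - by rewrite mul1r mul0r !subr0 gez0_abs ?sqr_ge0.
  have [s0|s0] := leP 0 s; first by exists r, s, p, q.
  exists (- r), (- s), p, q; split.
  - by rewrite -dt; ring.
  - by rewrite oppr_ge0 ltW.
  - by move: g0; congr (_ < _); ring.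
  - by move: g12; congr (_ <= _); ring.
  - by move: gg; congr (_ <= _); ring.
have pos (r s p q : int) : (r * q - s * p) ^+ 2 = 1 ->
    0 < (r * H - s * k) ^+ 2 + s ^+ 2.
  move=> dt; rewrite lt_neqAle addr_ge0 ?sqr_ge0 // andbT eq_sym.
  rewrite paddr_eq0 ?sqr_ge0 // !sqrf_eq0.
  apply/negP => /andP[/eqP X0 /eqP s0]; move: X0 dt; rewrite s0.
  rewrite !mul0r !subr0 => /eqP; rewrite mulf_eq0 (gt_eqF H0) orbF => /eqP ->.
  by rewrite mul0r expr0n.
elim=> [|n IHn] r s p q dt; set X1 := r * H - s * k;
  set g1 := X1 ^+ 2 + s ^+ 2; have g1_gt0 : 0 < g1 by exact: pos dt.
  by move: g1_gt0; lia.
move=> g1n.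
(* [w / g1] is the coefficient of the projection of the second vector on the
   first; [u] is the nearest integer. *)
pose w := X1 * (p * H - q * k) + s * q.
pose u := ((2 * w + g1) %/ (2 * g1))%Z.
pose p' := p - u * r; pose q' := q - u * s.
pose X2 := p' * H - q' * k; pose g2 := X2 ^+ 2 + q' ^+ 2.
pose w' := X1 * X2 + s * q'.
have w'E : w' = w - u * g1 by rewrite /w' /X2 /p' /q' /w /g1 /X1; ring.
have w'g : `|2 * w'| <= g1.
  have := divz_eq (2 * w + g1) (2 * g1); rewrite -/u.
  have := @ltz_pmod (2 * w + g1) (2 * g1).
  have := @modz_ge0 (2 * w + g1) (2 * g1).
  rewrite w'E; move: (modz _ _) g1_gt0 => rem; clearbody g1 w u; clear.
  by move: (u * g1) (mulrCA u 2 g1) => ug ->; lia.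
have dt' : (r * q' - s * p') ^+ 2 = 1 by rewrite -dt /q' /p'; ring.
have lagrange : g1 * g2 = w' ^+ 2 + H ^+ 2.
  rewrite -[H ^+ 2]mul1r -dt' /g1 /g2 /w' /X1 /X2; ring.
have [g12|g21] := leP g1 g2.
  exists r, s, p', q'; split=> //; rewrite -/X1 -/g1 -/X2 -/g2.
  have le4 : 4 * w' ^+ 2 <= g1 * g2.
    apply: (@le_trans _ _ (g1 ^+ 2)); last by rewrite expr2 ler_wpM2l // ltW.
    have -> : 4 * w' ^+ 2 = `|2 * w'| ^+ 2.
      by rewrite -normrX ger0_norm ?sqr_ge0 //; ring.
    by rewrite lerXn2r ?nnegrE // ltW.
  move: lagrange le4 (sqr_ge0 H); move: (g1 * g2) (w' ^+ 2) (H ^+ 2).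
  by move=> P W H2; clear; lia.
apply: (IHn p' q' r s); first by rewrite -[RHS]dt'; ring.
have g2n : g2 < n.+1%:Z by exact: lt_le_trans g21 g1n.
by move: g2n; rewrite -addn1 PoszD ltzD1.
Qed.

(** * The average height of the points (k + i)/H *)

(** The terms are comparable to the increments of the bounded increasing
    function [y / (1 + |y|)], an algebraic substitute for the arctangent. *)
Lemma sum_inv_sqr_le (R : realFieldType) (x : R) (n : nat) :
  \sum_(0 <= k < n) ((k%:R - x) ^+ 2 + 1)^-1 <= 8.
Proof.
pose phi (y : R) := y / (1 + `|y|).
have phi_lt y : `|phi y| <= 1.
  have y0 := normr_ge0 y.
  rewrite /phi normrM normfV (@ger0_norm _ (1 + _)) ?addr_ge0 //.
  by rewrite ler_pdivrMr ?mul1r; lra.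
have step y : (y ^+ 2 + 1)^-1 <= 4 * (phi (y + 1) - phi y).
  rewrite /phi; case: (lerP 0 y) => [y0|y0].
    rewrite !ger0_norm //; last lra.
    rewrite (_ : _ * _ = 4 / ((1 + (y + 1)) * (1 + y))); last first.
      by field; apply/andP; split; lra.
    rewrite -[leLHS]mul1r ler_pdivrMr ?ltr_wpDl ?sqr_ge0 //.
    rewrite mulrAC ler_pdivlMr; last by rewrite mulr_gt0 //; lra.
    nra.
  rewrite (ltr0_norm y0); case: (lerP 0 (y + 1)) => [y1|y1].
    rewrite ger0_norm //.
    rewrite -[leLHS]mul1r ler_pdivrMr ?ltr_wpDl ?sqr_ge0 //.
    have -> : 4 * ((y + 1) / (1 + (y + 1)) - y / (1 - y)) =
      4 * (1 - 2 * y - 2 * y ^+ 2) / ((2 + y) * (1 - y)).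
      by field; apply/andP; split; lra.
    rewrite mulrAC ler_pdivlMr; last by rewrite mulr_gt0 //; lra.
    nra.
  rewrite ltr0_norm //.
  rewrite (_ : _ * _ = 4 / (- y * (1 - y))); last first.
    by field; apply/and3P; split; lra.
  rewrite -[leLHS]mul1r ler_pdivrMr ?ltr_wpDl ?sqr_ge0 //.
  rewrite mulrAC ler_pdivlMr; last by rewrite mulr_gt0 //; lra.
  nra.
clearbody phi.
apply: (@le_trans _ _ (\sum_(0 <= k < n)
    4 * (phi (k.+1%:R - x) - phi (k%:R - x)))).
  apply: ler_sum => k _; apply: le_trans (step _) _.
  by rewrite -[k.+1%:R]natr1 [k%:R + 1 - x]addrAC.
rewrite -mulr_sumr (telescope_sumr (fun k => phi (k%:R - x))) //.
have := phi_lt (n%:R - x); have := phi_lt (0%:R - x).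
by rewrite !ler_norml => /andP[? ?] /andP[? ?]; lra.
Qed.

Lemma harmonic_le_ln (R : realType) (n : nat) : (0 < n)%N ->
  \sum_(1 <= s < n.+1) s%:R^-1 <= 1 + ln n%:R :> R.
Proof.
elim: n => // -[|n] IHn _; first by rewrite big_nat1 invr1 ln1 addr0.
rewrite big_nat_recr //=; apply: le_trans (lerD (IHn isT) (lexx _)) _.
suff : n.+2%:R^-1 <= ln n.+2%:R - ln n.+1%:R :> R by move: (_^-1) => ?; lra.
have n1 : 0 < n.+1%:R :> R by rewrite ltr0n.
have n2 : 0 < n.+2%:R :> R by rewrite ltr0n.
have : ln (1 + (- n.+2%:R^-1)) <= - n.+2%:R^-1 :> R.
  by rewrite le_ln1Dx // ltrN2 invf_lt1 // ltr1n.
have -> : 1 + (- n.+2%:R^-1) = n.+1%:R / n.+2%:R :> R.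
  have -> : n.+1%:R = n.+2%:R - 1 :> R by rewrite -[n.+2%:R]natr1 addrK.
  by rewrite mulrBl divff ?lt0r_neq0 // mul1r.
rewrite ln_div ?posrE //; move: (_^-1) (ln _) (ln _) => ? ? ?; lra.
Qed.

(** Instead of one vector for each [k], all pairs [(r, s)] that can occur for
    some [k] are admitted. For fixed [r] and [s > 0] the sum over [k] of
    [H / ((rH - sk)^2 + s^2)] is [O(H / s^2)], and only [O(s)] values of [r] occur
    since [k < H]. What remains is a harmonic sum. *)
Lemma sum_height_le (R : realType) (H : nat) (r s : nat -> int) :
  let g k : R := ((r k * H%:Z - s k * k%:Z) ^+ 2 + s k ^+ 2)%:~R in
  (0 < H)%N ->
  (forall k, (k < H)%N -> [/\ 0 <= s k, 0 < g k & g k <= 2 * H%:R]) ->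
  \sum_(0 <= k < H) H%:R / g k
    <= H%:R * (1 + 56 * \sum_(1 <= i < (2 * H).+1) i%:R^-1).
Proof.
move=> g H0 gP.
have HR : 1 <= H%:R :> R by rewrite ler1n.
(* [i] stands for [s] and [l] for [r + 3 s], which is nonnegative. *)
pose w (k i l : nat) : R :=
  H%:R / (((l%:R - 3 * i%:R) * H%:R - i%:R * k%:R) ^+ 2 + i%:R ^+ 2).
have w0 k i l : 0 <= w k i l.
  by rewrite divr_ge0 // addr_ge0 ?sqr_ge0.
have term k : (k < H)%N -> H%:R / g k
    <= 1 + \sum_(1 <= i < (2 * H).+1) \sum_(0 <= l < 7 * i) w k i l.
  move=> kH; have [s0 g0 g2] := gP k kH.
  have W0 : 0 <= \sum_(1 <= i < (2 * H).+1) \sum_(0 <= l < 7 * i) w k i l.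
    by apply: sumr_ge0 => i _; apply: sumr_ge0.
  have gI : ((r k * H%:Z - s k * k%:Z) ^+ 2 + s k ^+ 2 <= 2 * H%:Z).
    by rewrite -(ler_int R) rmorphM.
  have [sk0|sk0] := eqVneq (s k) 0.
    (* Here [g k] is a nonzero multiple of [H^2]: the height is at most 1. *)
    apply: (@le_trans _ _ 1); last by rewrite lerDl.
    have gE : (r k * H%:Z - s k * k%:Z) ^+ 2 + s k ^+ 2 = (r k * H%:Z) ^+ 2.
      by rewrite sk0; ring.
    rewrite ler_pdivrMr // mul1r /g -[H%:R]/(H%:Z%:~R) ler_int gE.
    have rk0 : r k != 0.
      by apply: contraTneq g0 => rk0; rewrite /g gE rk0 mul0r expr0n ltxx.
    have r1 : 1 <= r k ^+ 2 by rewrite -gtz0_ge1 exprn_even_gt0.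
    have H1 : 1 <= H%:Z by lia.
    rewrite exprMn (le_trans (ler_eXnr (_ : 0 < 2)%N H1)) // ler_peMl //.
  have s2 : (`|s k| <= 2 * H)%N by clear -gI; nia.
  have rl : `|r k * H%:Z - s k * k%:Z| <= 2 * H%:Z by clear -gI H0; nia.
  have rs : `|r k| <= `|s k| + 2 by clear -rl kH; nia.
  pose i := `|s k|%N; pose l := absz (r k + 3 * s k).
  have iE : i%:R = (s k)%:~R :> R by rewrite /i natr_absz ger0_norm.
  have lE : l%:R = (r k + 3 * s k)%:~R :> R.
    by rewrite /l natr_absz ger0_norm //; lia.
  have -> : H%:R / g k = w k i l.
    rewrite /w iE lE /g; congr (_ / _).
    by rewrite !(rmorphD, rmorphB, rmorphM, rmorphXn) /=; ring.
  rewrite -[leLHS]add0r lerD //.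
  rewrite (big_rem i) /=; last by rewrite mem_index_iota /i; lia.
  rewrite (big_rem l) /=; last by rewrite mem_index_iota /l /i; lia.
  rewrite -addrA lerDl addr_ge0 //; first exact: sumr_ge0.
  by apply: sumr_ge0 => ? _; exact: sumr_ge0.
apply: (@le_trans _ _ (\sum_(0 <= k < H)
    (1 + \sum_(1 <= i < (2 * H).+1) \sum_(0 <= l < 7 * i) w k i l))).
  by rewrite !big_mkord; apply: ler_sum => k _; exact: term.
rewrite big_split /= mulrDr mulr1 sumr_const_nat subn0 lerD2l.
rewrite exchange_big /= mulrA mulr_sumr big_nat_cond [leRHS]big_nat_cond.
apply: ler_sum => i; rewrite andbT => /andP[i0 _].
have iR : 0 < i%:R :> R by rewrite ltr0n.
rewrite exchange_big /=.
apply: (@le_trans _ _ (\sum_(0 <= l < 7 * i) H%:R / i%:R ^+ 2 * 8)).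
  apply: ler_sum => l _.
  pose x : R := (l%:R - 3 * i%:R) * H%:R / i%:R.
  apply: le_trans (ler_wpM2l _ (sum_inv_sqr_le x H)).
    rewrite mulr_sumr; apply: ler_sum => k _; rewrite /w.
    rewrite -[leRHS]mulrA -invfM le_eqVlt; apply/orP; left; apply/eqP.
    by congr (_ / _); rewrite /x; field; exact: lt0r_neq0.
  by rewrite divr_ge0 ?sqr_ge0.
rewrite sumr_const_nat subn0 -[leLHS]mulr_natl natrM le_eqVlt; apply/orP; left.
by apply/eqP; field; exact: lt0r_neq0.
Qed.

(** * Integral quadratic forms in a box *)

Lemma cauchy_schwarz2 (R : realFieldType) (x y z w h : R) : 0 <= h ->
  (x ^+ 2 + z ^+ 2) * (y ^+ 2 + w ^+ 2) <= 2 * h ^+ 2 ->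
  `|x * y| + `|z * w| <= 3 / 2 * h.
Proof.
move=> h0 xyzw; have h32 : 0 <= 3 / 2 * h by lra.
rewrite -ler_sqr ?nnegrE ?addr_ge0 //.
apply: (@le_trans _ _ (2 * h ^+ 2)); last by have := sqr_ge0 h; nra.
apply: le_trans xyzw; rewrite !normrM.
rewrite -[x ^+ 2]real_normK ?num_real // -[y ^+ 2]real_normK ?num_real //.
rewrite -[z ^+ 2]real_normK ?num_real // -[w ^+ 2]real_normK ?num_real //.
move: `|x| `|y| `|z| `|w| => X Y Z W.
by rewrite -subr_ge0 (_ : _ - _ = (X * W - Z * Y) ^+ 2) ?sqr_ge0 //; ring.
Qed.

Lemma form_le_box (R : realFieldType) (B h a b c u v w : R) : 0 < h -> 0 <= B ->
  `|a| <= B * h -> `|b| <= B -> `|c| <= B / h ->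
  `|a * (u / h ^+ 2) + b * (v / h) + c * w| <= B / h * (`|u| + `|v| + `|w|).
Proof.
move=> h0 B0 ah bh ch.
have n0 : 0 <= h^-1 by rewrite invr_ge0 ltW.
apply: le_trans (ler_normD _ _) _; rewrite mulrDr lerD //; last first.
  by rewrite normrM ler_wpM2r.
apply: le_trans (ler_normD _ _) _; rewrite mulrDr lerD //.
  rewrite normrM (_ : B / h * _ = B * h * (`|u| / h ^+ 2)).
    rewrite normrM normfV (@ger0_norm _ (h ^+ 2)) ?sqr_ge0 // ler_wpM2r //.
    by rewrite divr_ge0 ?sqr_ge0.
  by field; exact: lt0r_neq0.
have -> : B / h * `|v| = B * (`|v| / h) by field; exact: lt0r_neq0.
rewrite normrM.
rewrite normrM normfV (@ger0_norm _ h) ?(ltW h0) // ler_wpM2r //.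
by rewrite divr_ge0 ?(ltW h0).
Qed.

(** A triple [((a, b), c)] stands for the binary quadratic form
    [a x^2 + b x y + c y^2]. *)
Definition form_val (f : int * int * int) (r s : int) : int :=
  f.1.1 * r ^+ 2 + f.1.2 * (r * s) + f.2 * s ^+ 2.

Definition form_polar (f : int * int * int) (r s p q : int) : int :=
  f.1.1 * (2 * (r * p)) + f.1.2 * (r * q + s * p) + f.2 * (2 * (s * q)).

(** The matrix with rows [(r, s)], [(p, q)] is unimodular, so the coefficients
    of a form are integral combinations of its values on this basis. *)
Lemma form_eq_basis (r s p q : int) (f g : int * int * int) :
  (r * q - s * p) ^+ 2 = 1 ->
  form_val f r s = form_val g r s ->
  form_polar f r s p q = form_polar g r s p q ->
  form_val f p q = form_val g p q -> f = g.
Proof.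
move=> dt e1 e12 e2.
have A (e : int * int * int) : e.1.1 =
    q ^+ 2 * form_val e r s - q * s * form_polar e r s p q
    + s ^+ 2 * form_val e p q.
  by rewrite -[LHS]mulr1 -[X in _ * X]dt /form_val /form_polar; ring.
have B (e : int * int * int) : e.1.2 =
    - 2 * (q * p) * form_val e r s + (q * r + s * p) * form_polar e r s p q
    - 2 * (s * r) * form_val e p q.
  by rewrite -[LHS]mulr1 -[X in _ * X]dt /form_val /form_polar; ring.
have C (e : int * int * int) : e.2 =
    p ^+ 2 * form_val e r s - p * r * form_polar e r s p q
    + r ^+ 2 * form_val e p q.
  by rewrite -[LHS]mulr1 -[X in _ * X]dt /form_val /form_polar; ring.
have := A f; have := B f; have := C f; rewrite e1 e12 e2 -A -B -C.
by case: f g {e1 e12 e2} => [[a b] c] [[a' b'] c'] /= -> -> ->.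
Qed.

(** In the coordinates adapted to [th = k/H], the vector [(r, s)] is
    [(X1/H, s)] and the box bounds the three coefficients of a form by [BH], [B],
    [B/H]. Hence the values of forms vary by at most [2 B g1 / H] at [(r, s)], by
    [2 B g2 / H] at [(p, q)], and the polar values vary by [O(B)] thanks to the
    Cauchy-Schwarz inequality and [g1 g2 <= 2H^2]. The box is described by
    differences of its elements because it need not be centred at the origin. *)
Lemma size_le_reduced_box (R : realType) (H k : nat) (B : R) (r s p q : int)
    (l : seq (int * int * int)) :
  let X1 := r * H%:Z - s * k%:Z in let X2 := p * H%:Z - q * k%:Z in
  let g1 := X1 ^+ 2 + s ^+ 2 in let g2 := X2 ^+ 2 + q ^+ 2 in
  let th : R := k%:R / H%:R in
  (0 < H)%N -> 1 <= B -> uniq l ->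
  [/\ (r * q - s * p) ^+ 2 = 1, 0 < g1, g1 <= g2 & g1 * g2 <= 2 * H%:Z ^+ 2] ->
  {in l &, forall f f', let a : R := (f.1.1 - f'.1.1)%:~R in
     let b : R := (f.1.2 - f'.1.2)%:~R in let c : R := (f.2 - f'.2)%:~R in
     [/\ `|a| <= B * H%:R, `|2 * a * th + b| <= B
       & `|a * th ^+ 2 + b * th + c| <= B / H%:R]} ->
  (size l)%:R <= 451 * B ^+ 3 + 88 * B ^+ 2 * (H%:R / g1%:~R).
Proof.
move=> X1 X2 g1 g2 th H0 B1 ul [dt g10 g12 gg] box.
have h0 : 0 < H%:R :> R by rewrite ltr0n.
have g1R : 0 < g1%:~R :> R by rewrite ltr0z.
have g2R : 0 < g2%:~R :> R by rewrite ltr0z (lt_le_trans g10).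
have ggR : g1%:~R * g2%:~R <= 2 * H%:R ^+ 2 :> R.
  by move: gg; rewrite -(ler_int R) !rmorphM.
have g12R : g1%:~R <= g2%:~R :> R by rewrite ler_int.
have B0 : 0 <= B by lra.
have BH : 0 <= B / H%:R by rewrite divr_ge0 // ltW.
have g1E : g1%:~R = X1%:~R ^+ 2 + s%:~R ^+ 2 :> R by rewrite rmorphD !rmorphXn.
have g2E : g2%:~R = X2%:~R ^+ 2 + q%:~R ^+ 2 :> R by rewrite rmorphD !rmorphXn.
have X1E : r%:~R = X1%:~R / H%:R + s%:~R * th :> R.
  by rewrite /X1 /th rmorphB !rmorphM /=; field; exact: lt0r_neq0.
have X2E : p%:~R = X2%:~R / H%:R + q%:~R * th :> R.
  by rewrite /X2 /th rmorphB !rmorphM /=; field; exact: lt0r_neq0.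
clearbody g1 g2 X1 X2 th.
have valP (x y z : int) (f f' : int * int * int) : f \in l -> f' \in l ->
    z%:~R = x%:~R / H%:R + y%:~R * th :> R ->
    `|(form_val f z y)%:~R - (form_val f' z y)%:~R|
      <= 2 * (B / H%:R) * (x%:~R ^+ 2 + y%:~R ^+ 2) :> R.
  move=> fl fl' zE; have /= [] := box f f' fl fl'.
  set a : R := (_ - _)%:~R; set b : R := (_ - _)%:~R; set c : R := (_ - _)%:~R.
  move=> ah bh ch.
  have -> : (form_val f z y)%:~R - (form_val f' z y)%:~R =
      a * (x%:~R ^+ 2 / H%:R ^+ 2) + (2 * a * th + b) * (x%:~R * y%:~R / H%:R)
      + (a * th ^+ 2 + b * th + c) * y%:~R ^+ 2.
    rewrite /a /b /c /form_val !(rmorphB, rmorphD, rmorphM, rmorphXn) /= zE.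
    by field; exact: lt0r_neq0.
  apply: le_trans (form_le_box _ _ _ h0 B0 ah bh ch) _.
  rewrite [2 * _]mulrC -[leRHS]mulrA ler_wpM2l // !normrX !real_normK ?num_real // normrM.
  rewrite -[x%:~R ^+ 2]real_normK ?num_real // -[y%:~R ^+ 2]real_normK ?num_real //.
  by have := sqr_ge0 (`|x%:~R| - `|y%:~R| : R); nra.
have polP (f f' : int * int * int) : f \in l -> f' \in l ->
    `|(form_polar f r s p q)%:~R - (form_polar f' r s p q)%:~R| <= 5 * B :> R.
  move=> fl fl'; have /= [] := box f f' fl fl'.
  set a : R := (_ - _)%:~R; set b : R := (_ - _)%:~R; set c : R := (_ - _)%:~R.
  move=> ah bh ch.
  have -> : (form_polar f r s p q)%:~R - (form_polar f' r s p q)%:~R =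
      a * (2 * (X1%:~R * X2%:~R) / H%:R ^+ 2)
      + (2 * a * th + b) * ((X1%:~R * q%:~R + s%:~R * X2%:~R) / H%:R)
      + (a * th ^+ 2 + b * th + c) * (2 * (s%:~R * q%:~R)) :> R.
    rewrite /a /b /c /form_polar !(rmorphB, rmorphD, rmorphM, rmorphXn) /= X1E X2E.
    by field; exact: lt0r_neq0.
  apply: le_trans (form_le_box _ _ _ h0 B0 ah bh ch) _.
  have cs1 : `|X1%:~R * X2%:~R| + `|s%:~R * q%:~R| <= 3 / 2 * H%:R :> R.
    by apply: cauchy_schwarz2; [exact: ltW | rewrite -g1E -g2E].
  have cs2 : `|X1%:~R * q%:~R| + `|s%:~R * X2%:~R| <= 3 / 2 * H%:R :> R.
    by apply: cauchy_schwarz2; [exact: ltW | rewrite -g1E [_ + X2%:~R ^+ 2]addrC -g2E].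
  rewrite (_ : 5 * B = B / H%:R * (5 * H%:R)); last by field; exact: lt0r_neq0.
  rewrite ler_wpM2l // [ `|2 * (X1%:~R * _)|]normrM [ `|2 * (s%:~R * _)|]normrM.
  rewrite (@ger0_norm _ 2) //.
  have := ler_normD (X1%:~R * q%:~R : R) (s%:~R * X2%:~R); lra.
have step3 z1 z2 z3 : (size [seq f <- [seq f <- [seq f <- l |
    form_val f r s == z1] | form_polar f r s p q == z2] | form_val f p q == z3])%:R
    <= 1 :> R.
  rewrite -[1]/(1%:R) ler_nat; set e := [seq f <- _ | _].
  have ue : uniq e by rewrite !filter_uniq.
  have memP f : f \in e ->
      [/\ form_val f r s = z1, form_polar f r s p q = z2 & form_val f p q = z3].
    by rewrite !mem_filter => /and4P[/eqP -> /eqP -> /eqP ->].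
  case: e ue memP => [|f [|f' e]] //= /andP[/norP[/eqP ff' _] _] memP.
  case: ff'; have [|f1 f2 f3] := memP f; first by rewrite mem_head.
  have [|f1' f2' f3'] := memP f'; first by rewrite inE mem_head orbT.
  by apply: (form_eq_basis dt); congruence.
have step2 z1 z2 : (size [seq f <- [seq f <- l | form_val f r s == z1]
      | form_polar f r s p q == z2])%:R
    <= (2 * (2 * (B / H%:R) * g2%:~R) + 1) * 1 :> R.
  apply: (size_le_diameter_fibre (f := fun f => form_val f p q)) => //.
  - move=> f f'; rewrite !mem_filter => /and3P[_ _ fl] /and3P[_ _ fl'].
    by rewrite g2E; exact: valP.
  - by rewrite !mulr_ge0 // ltW.
have step1 z1 : (size [seq f <- l | form_val f r s == z1])%:R
    <= (2 * (5 * B) + 1) * ((2 * (2 * (B / H%:R) * g2%:~R) + 1) * 1) :> R.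
  apply: (size_le_diameter_fibre (f := fun f => form_polar f r s p q)) => //.
  - move=> f f'; rewrite !mem_filter => /andP[_ fl] /andP[_ fl'].
    exact: polP.
  - by rewrite mulr_ge0.
  - by rewrite mulr1 addr_ge0 // !mulr_ge0 // ltW.
have := @size_le_diameter_fibre R _ l (fun f => form_val f r s)
  (2 * (B / H%:R) * g1%:~R) _ _ _ _ step1.
move=> /(_ _ _ _) /le_trans; apply.
- by move=> f f' fl fl'; rewrite g1E; exact: valP.
- by rewrite !mulr_ge0 // ltW.
- by rewrite !mulr_ge0 // ?addr_ge0 // ?mulr_ge0 // ltW.
(* It remains to bound [(4Bu + 1)(10B + 1)(4Bv + 1)], where [uv <= 2]. *)
pose u : R := g1%:~R / H%:R; pose v : R := g2%:~R / H%:R.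
have u0 : 0 < u by rewrite divr_gt0.
have v0 : 0 < v by rewrite divr_gt0.
have uv : u * v <= 2.
  by rewrite /u /v mulrACA -invfM -expr2 ler_pdivrMr // exprn_gt0.
have uv' : u <= v by rewrite ler_wpM2r // invr_ge0 ltW.
have u2 : u <= 2 by nra.
have vu : v <= 2 * u^-1 by rewrite -ler_pdivrMr ?invr_gt0 // invrK mulrC.
have iu : 0 < u^-1 by rewrite invr_gt0.
have -> : H%:R / g1%:~R = u^-1 by rewrite /u invf_div.
have -> : 2 * (B / H%:R) * g1%:~R = 2 * (B * u) by rewrite /u; ring.
have -> : 2 * (B / H%:R) * g2%:~R = 2 * (B * v) by rewrite /v; ring.
move: (u^-1) vu iu => w vw w0.
have Bu : B * u <= B * 2 by rewrite ler_wpM2l.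
have Bv : B * v <= B * (2 * w) by rewrite ler_wpM2l.
have BB : B ^+ 2 * (u * v) <= B ^+ 2 * 2 by rewrite ler_wpM2l ?sqr_ge0.
have B2 : B <= B ^+ 2 by rewrite ler_eXnr.
have P : (2 * (2 * (B * u)) + 1) * (2 * (2 * (B * v)) + 1)
    <= 41 * B ^+ 2 + 8 * (B * w).
  rewrite (_ : _ * _ = 16 * (B ^+ 2 * (u * v)) + 4 * (B * u) + 4 * (B * v) + 1).
    by lra.
  by ring.
have Q : 41 * B ^+ 2 + 8 * (B * w) >= 0.
  by rewrite addr_ge0 ?mulr_ge0 ?sqr_ge0 // ltW.
rewrite mulr1 mulrCA.
apply: (@le_trans _ _ (11 * B * (41 * B ^+ 2 + 8 * (B * w)))).
  apply: (le_trans (ler_wpM2l _ P)); first by lra.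
  by apply: ler_wpM2r => //; lra.
by rewrite le_eqVlt; apply/orP; left; apply/eqP; ring.
Qed.

(** * From points near the curve to quadratic forms *)

(** With [w = sqrt m], the fraction [t] with denominator [H] is chosen so that
    [0 <= w - t < 1/H]. Then [m - t^2 = (w - t)(w + t)], and
    [2n - 3tm + t^3] is the sum of [2(n - w^3)], which is at most [2X/N], and of
    [(w - t)^2 (2w + t)]. *)
Lemma near_pair_grid (R : realType) (N X rho : R) (H : nat) (m n : int) :
  let t := (Num.truncn (H%:R * Num.sqrt m%:~R : R))%:R / H%:R : R in
  1 <= rho -> N = rho ^+ 3 -> X <= N -> X / N <= rho / H%:R ^+ 2 -> (0 < H)%N ->
  near_pairs N X (m, n) ->
  [/\ 0 <= t <= 2 * rho, 0 <= m%:~R - t ^+ 2 <= 4 * rho / H%:R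
    & `|2 * n%:~R - 3 * t * m%:~R + t ^+ 3| <= 8 * rho / H%:R ^+ 2].
Proof.
move=> t rho1 NE XN XNH H0 [/andP[Nn n2N] mnX].
have rho0 : 0 < rho by lra.
have N1 : 1 <= N by rewrite NE exprn_ege1.
have h0 : 0 < H%:R :> R by rewrite ltr0n.
move: mnX; rewrite ler_norml => /andP[mnX1 mnX2].
have N2 : N <= N ^+ 2 by rewrite ler_eXnr.
have n2 : N ^+ 2 <= n%:~R ^+ 2 by rewrite lerXn2r ?nnegrE //; lra.
have n4 : n%:~R ^+ 2 <= (2 * N) ^+ 2 by rewrite lerXn2r ?nnegrE //; lra.
have m0 : 0 <= m%:~R :> R.
  rewrite leNgt; apply/negP => m_lt0.
  have : (m%:~R : R) ^+ 3 < 0 by rewrite exprn_odd_lt0.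
  lra.
pose w : R := Num.sqrt m%:~R.
have w0 : 0 <= w by exact: sqrtr_ge0.
have w2 : w ^+ 2 = m%:~R by rewrite sqr_sqrtr.
have w6 : w ^+ 6 = m%:~R ^+ 3 by rewrite -w2 -exprM.
have w2rho : w <= 2 * rho.
  rewrite -(@ler_pXn2r _ 6) ?nnegrE //; last lra.
  rewrite w6 exprMn; have -> : rho ^+ 6 = N ^+ 2 by rewrite NE -exprM.
  by rewrite exprMn in n4; lra.
have nw : `|n%:~R - w ^+ 3| <= X / N.
  have w3 : 0 <= w ^+ 3 by rewrite exprn_ge0.
  rewrite ler_pdivlMr; last lra.
  apply: (@le_trans _ _ (`|n%:~R - w ^+ 3| * (n%:~R + w ^+ 3))).
    by rewrite ler_wpM2l //; lra.
  rewrite -[X in _ * X]ger0_norm; last lra.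
  rewrite -normrM ler_norml; have -> : (n%:~R - w ^+ 3) * (n%:~R + w ^+ 3) =
      n%:~R ^+ 2 - m%:~R ^+ 3 :> R by rewrite -w6; ring.
  by rewrite mnX1.
have /andP[t1 t2] : t <= w < t + H%:R^-1.
  have /truncn_itv/andP[T1 T2] : 0 <= H%:R * w by rewrite mulr_ge0 // ltW.
  apply/andP; split; first by rewrite /t -/w ler_pdivrMr // [leRHS]mulrC.
  rewrite /t -/w.
  have -> : (Num.truncn (H%:R * w))%:R / H%:R + H%:R^-1 =
     (Num.truncn (H%:R * w)).+1%:R / H%:R :> R by rewrite -natr1 mulrDl mul1r.
  by rewrite ltr_pdivlMr // mulrC.
have t0 : 0 <= t by rewrite divr_ge0 // ltW.
clearbody t w.
pose d := w - t.
have d0 : 0 <= d by rewrite subr_ge0.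
have dH : d <= H%:R^-1 by rewrite /d; lra.
split.
- by rewrite t0; lra.
- rewrite -w2 (_ : _ - _ = d * (w + t)); last by rewrite /d; ring.
  apply/andP; split; first by rewrite mulr_ge0 // addr_ge0.
  by rewrite [leRHS]mulrC; apply: ler_pM => //; [exact: addr_ge0 | lra].
rewrite -w2 (_ : _ + _ = 2 * (n%:~R - w ^+ 3) + d ^+ 2 * (2 * w + t)); last first.
  by rewrite /d; ring.
apply: le_trans (ler_normD _ _) _.
rewrite normrM (@ger0_norm _ 2) // (@ger0_norm _ (_ * _)); last first.
  by rewrite mulr_ge0 ?sqr_ge0 ?addr_ge0 ?mulr_ge0.
have : d ^+ 2 * (2 * w + t) <= H%:R^-1 ^+ 2 * (6 * rho).
  apply: ler_pM; rewrite ?sqr_ge0 ?addr_ge0 ?mulr_ge0 //; last lra.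
  by rewrite lerXn2r ?nnegrE // invr_ge0 ltW.
have -> : 8 * rho / H%:R ^+ 2 = 2 * (rho / H%:R ^+ 2) + H%:R^-1 ^+ 2 * (6 * rho).
  by field; exact: lt0r_neq0.
by move: (le_trans nw XNH); lra.
Qed.

(** The form [f] such that [f(Y) + Y^3 = 2n - 3tm + t^3] for [t = j + Y]. *)
Definition tangent_form (j m n : int) : int * int * int :=
  (3 * j, 3 * (j ^+ 2 - m), 2 * n - 3 * j * m + j ^+ 3).

(** The fractions [t = i/H] attached to the points are sorted by [k = i %% H];
    for each [k] the tangent forms lie in a common box. *)
Lemma size_near_pairs_grid (R : realType) (N X rho : R) (H : nat)
    (s : seq (int * int)) :
  1 <= rho -> N = rho ^+ 3 -> X <= N -> X / N <= rho / H%:R ^+ 2 ->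
  (0 < H)%N -> H%:R <= rho ->
  uniq s -> (forall p, p \in s -> near_pairs N X p) ->
  (size s)%:R <= 451 * 16 ^+ 3 * ((rho / H%:R) ^+ 2 * rho)
    + 88 * 16 ^+ 2 * 113 * (rho / H%:R * rho * (1 + ln H%:R)).
Proof.
move=> rho1 NE XN XNH H0 Hrho us sP; set A := rho / H%:R.
have h0 : 0 < H%:R :> R by rewrite ltr0n.
have A1 : 1 <= A by rewrite ler_pdivlMr ?mul1r.
pose idx (p : int * int) := Num.truncn (H%:R * Num.sqrt p.1%:~R : R).
pose Phi (p : int * int) := tangent_form (idx p %/ H)%N%:Z p.1 p.2.
have PhiI : injective Phi.
  move=> [m n] [m' n']; rewrite /Phi /tangent_form; move: (_ %/ _)%N (_ %/ _)%N.
  by move=> j j' /= [] ? ? ?; congr (_, _); nia.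
have [r] := choice (fun k : nat => gauss_reduction k%:Z (H0 : 0 < H%:Z)).
move=> /choice[l /choice[p /choice[q gP]]].
pose g k : int := (r k * H%:Z - l k * k%:Z) ^+ 2 + l k ^+ 2.
have g2H k : g k <= 2 * H%:Z.
  have [_ _ g0 g12 gg] := gP k; rewrite -/(g k) in g0 g12 gg.
  rewrite -ler_sqr ?nnegrE ?mulr_ge0 ?(ltW g0) //.
  apply: (@le_trans _ _ (2 * H%:Z ^+ 2)).
    by apply: le_trans gg; rewrite expr2 ler_wpM2l // ltW.
  by rewrite exprMn ler_wpM2r ?sqr_ge0.
have cell k : (k < H)%N -> (size [seq x <- s | (idx x %% H)%N == k])%:R
    <= 451 * (16 * A) ^+ 3 + 88 * (16 * A) ^+ 2 * (H%:R / (g k)%:~R).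
  move=> kH; rewrite -(size_map Phi).
  have [dt _ g0 g12 gg] := gP k.
  apply: (size_le_reduced_box (k := k) H0 _ _ (And4 dt g0 g12 gg)).
  - lra.
  - by rewrite map_inj_uniq // filter_uniq.
  set th : R := k%:R / H%:R.
  (* [3 th^2] and [th^3] depend on [k] only, so they disappear from the
     differences of two forms. *)
  pose box (a b c : R) :=
    [/\ 0 <= a <= 6 * (A * H%:R), - 12 * A <= 2 * a * th + b + 3 * th ^+ 2 <= 0
      & `|a * th ^+ 2 + b * th + c + th ^+ 3| <= 8 * A / H%:R].
  have pt x : x \in [seq x <- s | (idx x %% H)%N == k] ->
      box (Phi x).1.1%:~R (Phi x).1.2%:~R (Phi x).2%:~R.
    rewrite mem_filter; case: x => m n /andP[/eqP xk /sP xN].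
    rewrite /box; set a := _.1.1%:~R; set b := _.1.2%:~R; set c := _.2%:~R.
    have [] := near_pair_grid rho1 NE XN XNH H0 xN.
    rewrite -[Num.truncn _]/(idx (m, n)) (divn_eq (idx (m, n)) H) xk.
    set j := (_ %/ _)%N; set t := (_ / _).
    have tE : t = j%:R + th.
      by rewrite /t /th natrD natrM mulrDl mulfK // lt0r_neq0.
    have aE : a = 3 * j%:R by rewrite /a rmorphM.
    have bE : b = 3 * (j%:R ^+ 2 - m%:~R).
      by rewrite /b /= rmorphM rmorphB rmorphXn.
    have cE : c = 2 * n%:~R - 3 * j%:R * m%:~R + j%:R ^+ 3.
      by rewrite /c /= rmorphD rmorphB rmorphXn !rmorphM.
    have th0 : 0 <= th by rewrite divr_ge0 // ltW.
    have rhoE : A * H%:R = rho by rewrite /A divfK // lt0r_neq0.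
    rewrite rhoE aE bE cE => /andP[t0 t2] /andP[mt0 mt4] E8; split.
    - by rewrite mulr_ge0 //; move: t2; rewrite tE; lra.
    - rewrite (_ : _ + 3 * th ^+ 2 = - 3 * (m%:~R - t ^+ 2)); last first.
        by rewrite tE; ring.
      by move: mt4; rewrite -mulrA -/A; lra.
    rewrite (_ : _ + th ^+ 3 = 2 * n%:~R - 3 * t * m%:~R + t ^+ 3); last first.
      by rewrite tE; ring.
    by apply: le_trans E8 _; rewrite le_eqVlt -mulrA /A expr2 invfM !mulrA eqxx.
  move=> _ _ /mapP[x xs ->] /mapP[y ys ->].
  rewrite !intrB; have := pt y ys; have := pt x xs; rewrite /box.
  move: (Phi x).1.1%:~R (Phi x).1.2%:~R (Phi x).2%:~R => a b c.
  move: (Phi y).1.1%:~R (Phi y).1.2%:~R (Phi y).2%:~R => a' b' c'.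
  rewrite !ler_norml => -[/andP[a1 a2] /andP[b1 b2] /andP[c1 c2]].
  move=> [/andP[a1' a2'] /andP[b1' b2'] /andP[c1' c2']].
  by split; apply/andP; split; lra.
have sum_cells : (size s)%:R <= \sum_(0 <= k < H)
    (451 * (16 * A) ^+ 3 + 88 * (16 * A) ^+ 2 * (H%:R / (g k)%:~R)).
  rewrite (@size_fibres _ _ s (index_iota 0 H) (fun x => idx x %% H)%N).
  - rewrite natr_sum big_nat_cond [leRHS]big_nat_cond.
    by apply: ler_sum => k /andP[/andP[_ kH] _]; exact: cell.
  - exact: iota_uniq.
  - by move=> _ /mapP[x _ ->]; rewrite mem_index_iota ltn_pmod.
have sumh : \sum_(0 <= k < H) H%:R / (g k)%:~R
    <= H%:R * (1 + 56 * \sum_(1 <= i < (2 * H).+1) i%:R^-1) :> R.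
  apply: (@sum_height_le R H r l H0) => k _; have [_ l0 g0 _ _] := gP k.
  split => //; first by rewrite ltr0z.
  by have := g2H k; rewrite -(ler_int R) rmorphM.
apply: (le_trans sum_cells); rewrite big_split /= sumr_const_nat subn0.
rewrite -mulr_sumr -[_ *+ H]mulr_natl.
have {}sumh : \sum_(0 <= k < H) H%:R / (g k)%:~R 
    <= H%:R * (113 * (1 + ln H%:R)) :> R.
  apply: (le_trans sumh).
  rewrite ler_wpM2l //; have := @harmonic_le_ln R (2 * H).
  rewrite muln_gt0 H0 natrM => /(_ isT) harm.
  have : ln 2 <= 1 :> R.
    have := @le_ln1Dx R 1; have -> : 1 + 1 = 2 :> R by [].
    by apply; lra.
  rewrite lnM ?posrE // in harm.
  have : 0 <= ln H%:R :> R by rewrite ln_ge0 // ler1n.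
  lra.
have rhoE : A * H%:R = rho by rewrite /A divfK // lt0r_neq0.
have -> : 451 * 16 ^+ 3 * (A ^+ 2 * rho) = H%:R * (451 * (16 * A) ^+ 3).
  by rewrite -rhoE; ring.
have -> : 88 * 16 ^+ 2 * 113 * (A * rho * (1 + ln H%:R)) =
    88 * (16 * A) ^+ 2 * (H%:R * (113 * (1 + ln H%:R))).
  by rewrite -rhoE; ring.
rewrite lerD2l ler_wpM2l // mulr_ge0 ?sqr_ge0 //.
Qed.

(** * The two ranges of X *)

(** Count [m] first: [|m|^3 <= (4 + L) N^2] leaves
    [O((4 + L) rho^2)] values of [m], and two values of [n] with the same [m]
    satisfy [2N |n - n'| <= |n^2 - n'^2| <= 2X]. *)
Lemma size_near_pairs_wide (R : realType) (N X rho L : R) (s : seq (int * int)) :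
  1 <= rho -> N = rho ^+ 3 -> N <= X -> 0 <= L -> X <= L * N ^+ 2 ->
  uniq s -> (forall p, p \in s -> near_pairs N X p) ->
  (size s)%:R <= 15 * (4 + L) * (X / rho).
Proof.
move=> rho1 NE NX L0 XL us sP.
have rho0 : 0 < rho by lra.
have N1 : 1 <= N by rewrite NE exprn_ege1.
have N0 : 0 < N by lra.
have mP p : p \in s -> `|p.1%:~R : R| <= (4 + L) * rho ^+ 2.
  case: p => m n /sP[/= /andP[Nn n2N] mn].
  have n4 : n%:~R ^+ 2 <= (2 * N) ^+ 2 by rewrite lerXn2r ?nnegrE //; lra.
  have L2 : 0 <= (4 + L) * rho ^+ 2 by rewrite mulr_ge0 ?sqr_ge0 //; lra.
  rewrite -(@ler_pXn2r _ 3) ?nnegrE // -normrX.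
  apply: (@le_trans _ _ ((4 + L) * N ^+ 2)).
    have := ler_normB (n%:~R ^+ 2 : R) (n%:~R ^+ 2 - m%:~R ^+ 3).
    rewrite opprB addrC subrK (@ger0_norm _ (n%:~R ^+ 2)) ?sqr_ge0 //.
    by rewrite exprMn in n4; lra.
  have -> : N ^+ 2 = (rho ^+ 2) ^+ 3 by rewrite NE -!exprM.
  rewrite [leRHS]exprMn; apply: ler_wpM2r; first by rewrite exprn_ge0 ?sqr_ge0.
  by apply: ler_eXnr => //; lra.
have diamN : {in s &, forall p p', p.1 = p'.1 ->
    `|p.2%:~R - p'.2%:~R| <= X / N :> R}.
  move=> [m n] [m' n'] /sP[/= /andP[Nn n2N] mn] /sP[/= /andP[Nn' n2N'] mn'] mm'.
  rewrite -{}mm' in mn'.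
  rewrite ler_pdivlMr // -(@ler_pM2l _ 2) // mulrCA.
  apply: (@le_trans _ _ (`|n%:~R - n'%:~R| * `|n%:~R + n'%:~R|)).
    by rewrite ler_wpM2l // ger0_norm; lra.
  rewrite -normrM.
  have -> : (n%:~R - n'%:~R) * (n%:~R + n'%:~R) = (n%:~R ^+ 2 - m%:~R ^+ 3)
     - (n'%:~R ^+ 2 - m%:~R ^+ 3) :> R by ring.
  by apply: le_trans (ler_normB _ _) _; lra.
have X0 : 0 <= X / N by rewrite divr_ge0 //; lra.
have fib m : (size [seq p <- s | p.1 == m])%:R <= 2 * (X / N) + 1.
  rewrite -(size_map snd); apply: size_le_diameter => //.
    rewrite map_inj_in_uniq ?filter_uniq // => -[m1 n1] [m2 n2].
    by rewrite !mem_filter /= => /andP[/eqP -> _] /andP[/eqP -> _] ->.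
  move=> _ _ /mapP[p + ->] /mapP[p' + ->]; rewrite !mem_filter.
  by move=> /andP[/eqP pm ps] /andP[/eqP pm' ps']; apply: diamN => //; rewrite pm.
have r2 : 1 <= rho ^+ 2 by rewrite exprn_ege1.
apply: (@le_trans _ _ ((2 * (2 * ((4 + L) * rho ^+ 2)) + 1) * (2 * (X / N) + 1))).
  apply: (@size_le_diameter_fibre _ _ _ fst) => //.
  - move=> p p' /mP pm /mP pm'; apply: le_trans (ler_normB _ _) _; lra.
  - by rewrite !mulr_ge0 //; lra.
  - by rewrite addr_ge0 // mulr_ge0.
have XN1 : 1 <= X / N by rewrite ler_pdivlMr // mul1r.
have -> : 15 * (4 + L) * (X / rho) = 5 * ((4 + L) * rho ^+ 2) * (3 * (X / N)).
  by rewrite NE; field; exact: lt0r_neq0.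
apply: ler_pM; [| | |lra].
- by rewrite addr_ge0 // !mulr_ge0 //; lra.
- by rewrite addr_ge0 // mulr_ge0.
have : 1 <= (4 + L) * rho ^+ 2 by rewrite mulr_ege1 //; lra.
lra.
Qed.

(** [X] is replaced by [X' = max X rho^2], and [H] is the integral part of
    [rho^2 / sqrt X'], the largest denominator for which the error [X'/N] does not
    exceed the deviation [rho/H^2] of the curve from its tangents. *)
Lemma size_near_pairs_narrow (R : realType) (N X rho : R) (s : seq (int * int)) :
  1 <= rho -> N = rho ^+ 3 -> 0 < X -> X <= N ->
  uniq s -> (forall p, p \in s -> near_pairs N X p) ->
  (size s)%:R <= (451 * 16 ^+ 3 + 88 * 16 ^+ 2 * 113)
    * (8 * (X / rho) + 8 * rho + rho * (1 + ln rho) ^+ 2).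
Proof.
move=> rho1 NE X0 XN us sP.
have rho0 : 0 < rho by lra.
have rr : rho ^+ 2 * rho = N by rewrite NE -exprSr.
have r2 : 0 < rho ^+ 2 by rewrite exprn_gt0.
have r12 : rho <= rho ^+ 2 by rewrite ler_eXnr.
have r23 : rho ^+ 2 <= N by rewrite -rr ler_peMr // ltW.
pose X' := Num.max X (rho ^+ 2); pose q := Num.sqrt X'.
have X'N : X' <= N by rewrite ge_max XN.
have rX' : rho ^+ 2 <= X' by rewrite le_max lexx orbT.
have X'X : X' <= X + rho ^+ 2 by rewrite ge_max; apply/andP; split; lra.
have q2 : q ^+ 2 = X' by rewrite sqr_sqrtr // (le_trans _ rX') ?sqr_ge0.
have q0 : 0 <= q by exact: sqrtr_ge0.
have rq : rho <= q by rewrite -ler_sqr ?nnegrE ?(ltW rho0) // q2.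
have q_gt0 : 0 < q by lra.
have qr : q <= rho ^+ 2.
  rewrite -ler_sqr ?nnegrE ?(ltW r2) // q2 (le_trans X'N) // -rr expr2.
  by rewrite ler_wpM2l // ltW.
have sP' p : p \in s -> near_pairs N X' p.
  case: p => m n /sP[Nn mn]; split=> //; apply: le_trans mn _.
  by rewrite le_max lexx.
pose x := rho ^+ 2 / q; pose H := Num.truncn x.
have x1 : 1 <= x by rewrite ler_pdivlMr ?mul1r.
have /truncn_itv/andP[Hx xH] : 0 <= x by lra.
have H0 : (0 < H)%N by rewrite truncn_gt0.
have h0 : 0 < H%:R :> R by rewrite ltr0n.
have Hq : H%:R * q <= rho ^+ 2 by rewrite -ler_pdivlMr.
have qH : rho ^+ 2 <= 2 * H%:R * q.
  rewrite -ler_pdivrMr //; apply: (le_trans (ltW xH)).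
  have : 1 <= H%:R :> R by rewrite ler1n.
  by rewrite -natr1 -/H; lra.
have Hrho : H%:R <= rho.
  by apply: (le_trans Hx); rewrite /x ler_pdivrMr // expr2 ler_wpM2l // ltW.
have XNH : X' / N <= rho / H%:R ^+ 2.
  rewrite ler_pdivrMr; last by rewrite -rr mulr_gt0.
  rewrite mulrAC ler_pdivlMr ?exprn_gt0 // -q2 -exprMn [q * _]mulrC.
  have -> : rho * N = (rho ^+ 2) ^+ 2 by rewrite -rr; ring.
  by rewrite lerXn2r ?nnegrE ?mulr_ge0 // ltW.
apply: le_trans (size_near_pairs_grid rho1 NE X'N XNH H0 Hrho us sP') _.
set A := rho / H%:R.
have A0 : 0 <= A by rewrite divr_ge0 // ltW.
have A2 : A ^+ 2 * rho <= 4 * (X / rho) + 4 * rho.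
  have Aq : A <= 2 * (q / rho).
    rewrite /A ler_pdivrMr // mulrA mulrAC ler_pdivlMr // -expr2.
    by rewrite mulrAC.
  apply: (@le_trans _ _ ((2 * (q / rho)) ^+ 2 * rho)).
    by rewrite ler_wpM2r ?(ltW rho0) // lerXn2r ?nnegrE // (le_trans A0).
  have -> : (2 * (q / rho)) ^+ 2 * rho = 4 * (q ^+ 2 / rho).
    by field; exact: lt0r_neq0.
  rewrite q2.
  have : X' / rho <= X / rho + rho.
    by rewrite ler_pdivrMr // mulrDl divfK ?lt0r_neq0 // -expr2.
  lra.
have lnH0 : 0 <= ln H%:R :> R by rewrite ln_ge0 // ler1n.
have lnH : ln H%:R <= ln rho by rewrite ler_ln.
(* Arithmetic-geometric mean inequality for [A] and [1 + ln rho]. *)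
have AL : A * rho * (1 + ln H%:R) <= A ^+ 2 * rho + rho * (1 + ln rho) ^+ 2.
  apply: (@le_trans _ _ (A * rho * (1 + ln rho))).
    by rewrite ler_wpM2l ?lerD2l // mulr_ge0 // ltW.
  rewrite -subr_ge0.
  have -> : A ^+ 2 * rho + rho * (1 + ln rho) ^+ 2 - A * rho * (1 + ln rho) =
    rho * ((A - (1 + ln rho) / 2) ^+ 2 + 3 / 4 * (1 + ln rho) ^+ 2) by field.
  by rewrite mulr_ge0 ?(ltW rho0) // addr_ge0 ?sqr_ge0 // mulr_ge0 ?sqr_ge0 // divr_ge0.
have rL : 0 <= rho * (1 + ln rho) ^+ 2 by rewrite mulr_ge0 ?sqr_ge0 // ltW.
have c1 : 0 <= 451 * 16 ^+ 3 :> R.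
  by apply: mulr_ge0; [exact: ler0n | apply: exprn_ge0; exact: ler0n].
have c2 : 0 <= 88 * 16 ^+ 2 * 113 :> R.
  apply: mulr_ge0; last exact: ler0n.
  by apply: mulr_ge0; [exact: ler0n | exact: sqr_ge0].
move: (451 * _) (88 * _ * _) c1 c2 => c1 c2 c1_ge0 c2_ge0.
have Xr : 0 <= X / rho by rewrite divr_ge0 // ltW.
by rewrite mulrDl; apply: lerD; apply: ler_wpM2l => //; lra.
Qed.

(** This uses [ln y <= y - 1] at [y = x^(a/2)]. *)
Lemma sqr_1Dln_le (R : realType) (x a : R) : 1 <= x -> 0 < a ->
  (1 + ln x) ^+ 2 <= (1 + 2 / a) ^+ 2 * x `^ a.
Proof.
move=> x1 a0; have x0 : 0 < x by lra.
have b0 : 0 < a / 2 by lra.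
have pow1 : 1 <= x `^ (a / 2).
  by rewrite -[leLHS](powRr0 x) ler_powR // ltW.
have lnx : ln x <= 2 / a * (x `^ (a / 2)).
  have : a / 2 * ln x <= x `^ (a / 2) - 1.
    rewrite -ln_powR -[X in ln X](subrK 1) addrC le_ln1Dx //; lra.
  move=> le1; have -> : ln x = 2 / a * (a / 2 * ln x).
    by field; exact: lt0r_neq0.
  rewrite ler_wpM2l ?divr_ge0 ?(ltW a0) //; lra.
have ln0 : 0 <= ln x by rewrite ln_ge0.
have a2 : 0 < 2 / a by rewrite divr_gt0.
have -> : x `^ a = (x `^ (a / 2)) ^+ 2.
  by rewrite -powR_mulrn ?powR_ge0 // -powRrM divfK.
rewrite -exprMn lerXn2r ?nnegrE ?mulr_ge0 ?addr_ge0 ?powR_ge0 // ?(ltW a2) //.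
by rewrite mulrDl mul1r lerD.
Qed.

Theorem theorem1p1 (R : realType) (eps c0 : R) (heps : 0 < eps) (hc0 : 0 < c0) :
  exists2 C : R, 0 < C &
    forall N X : R, 1 <= N -> 0 < X -> c0 * X `^ (1 / 2) <= N ->
      let M := N `^ (2 / 3) in
      (T N X)%:R <= C * (X * M / N + N `^ (1 / 3 + eps)).
Proof.
pose K : R := 451 * 16 ^+ 3 + 88 * 16 ^+ 2 * 113.
have K0 : 0 <= K.
  apply: addr_ge0; first by apply: mulr_ge0; [exact: ler0n | apply: exprn_ge0; exact: ler0n].
  apply: mulr_ge0; last exact: ler0n.
  by apply: mulr_ge0; [exact: ler0n | exact: sqr_ge0].
have L0 : 0 < c0 ^- 2 by rewrite invr_gt0 exprn_gt0.
pose e : R := (1 + 2 / eps) ^+ 2.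
have e0 : 0 <= e by exact: sqr_ge0.
have C10 : 0 < 15 * (4 + c0 ^- 2) by lra.
have K80 : 0 <= K * (8 + e) by rewrite mulr_ge0 // addr_ge0.
exists (15 * (4 + c0 ^- 2) + K * (8 + e)); first by lra.
move=> N X N1 X0 cX; cbv zeta; set M := N `^ (2 / 3).
have N0 : 0 < N by lra.
pose rho := N `^ (1 / 3).
have rho1 : 1 <= rho by rewrite -[leLHS](powRr0 N) ler_powR.
have rho0 : 0 < rho by lra.
have NE : N = rho ^+ 3.
  by rewrite -powR_mulrn ?powR_ge0 // -powRrM divfK ?powRr1 // ltW.
have ME : M = rho ^+ 2.
  by rewrite -powR_mulrn ?powR_ge0 // -powRrM /M mulrAC mul1r.
have -> : X * M / N = X / rho.
  by rewrite ME [in X in _ / X]NE; field; exact: lt0r_neq0.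
have N10 : N != 0 by exact: lt0r_neq0.
have -> : N `^ (1 / 3 + eps) = rho * N `^ eps.
  by rewrite powRD // N10 implybT.
have Neps : 1 <= N `^ eps by rewrite -[leLHS](powRr0 N) ler_powR // ltW.
have XL : X <= c0 ^- 2 * N ^+ 2.
  rewrite mulrC ler_pdivlMr ?exprn_gt0 //.
  rewrite -[X](sqr_sqrtr (ltW X0)) -powR12_sqrt ?(ltW X0) // -div1r -exprMn mulrC.
  by rewrite lerXn2r ?nnegrE ?mulr_ge0 ?powR_ge0 // ltW.
have Xr : 0 <= X / rho by rewrite divr_ge0 // ltW.
have rN : 0 <= rho * N `^ eps by rewrite mulr_ge0 ?powR_ge0 // ltW.
rewrite /T; have fin := finite_near_pairs N X.
set s := finmap.enum_fset (fset_set (near_pairs N X)).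
have us : uniq s by exact: finmap.fset_uniq.
have sP p : p \in s -> near_pairs N X p by move=> ps; apply/set_mem; rewrite -in_fset_set.
rewrite -[#|` _|]/(size s).
have [XN|NX] := lerP X N.
  apply: le_trans (size_near_pairs_narrow rho1 NE X0 XN us sP) _; rewrite -/K.
  apply: (@le_trans _ _ (K * (8 + e) * (X / rho + rho * N `^ eps))); last first.
    by rewrite ler_wpM2r ?addr_ge0 // lerDr ltW.
  rewrite -mulrA ler_wpM2l //.
  have lnrho : (1 + ln rho) ^+ 2 <= e * N `^ eps.
    apply: le_trans (sqr_1Dln_le N1 heps).
    have ln0 : 0 <= ln rho by rewrite ln_ge0.
    rewrite lerXn2r ?nnegrE ?addr_ge0 ?ln_ge0 // lerD2l ler_ln ?posrE //.
    by rewrite NE ler_eXnr.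
  have r1 : rho <= rho * N `^ eps by rewrite ler_peMr // ltW.
  have r2 := ler_wpM2l (ltW rho0) lnrho.
  have eX : 0 <= e * (X / rho) by rewrite mulr_ge0.
  by rewrite mulrCA in r2; rewrite mulrDr !mulrDl; lra.
apply: (le_trans (size_near_pairs_wide rho1 NE (ltW NX) (ltW L0) XL us sP)).
apply: (@le_trans _ _ (15 * (4 + c0 ^- 2) * (X / rho + rho * N `^ eps))).
  by rewrite ler_wpM2l ?(ltW C10) // lerDl.
by rewrite ler_wpM2r ?addr_ge0 // lerDl.
Qed.
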